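(* Let $0<s<1$ be rational. There is a $\Pi^0_2$ class $G\subseteq2^\omega$ with $\mathcal H^s(G)>0$ such that the following holds: whenever $x\in2^\omega$ is such that some $\Pi^0_1(x)$ subclass of $G$ has non-zero $\mathcal H^s$-measure, then $H\le_T x$ for every hyperarithmetic $H\subseteq\omega$.
   Context: Cantor space $2^\omega$ carries the metric $d(x,y)=2^{-\min\{n:x(n)\ne y(n)\}}$ for $x\ne y$; $\mathcal H^s$ denotes $s$-dimensional Hausdorff measure with respect to this metric. $\le_T$ is Turing reducibility. *)

(* Defs.v *)
From Stdlib Require Import Reals List Arith Cantor.
Open Scope nat_scope.
Import ListNotations.

Definition cantor := nat -> bool.
Definition cls := cantor -> Prop.

Definition prefix {A} (y : nat -> A) (n : nat) : list A := map y (seq 0 n).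

Definition in_cyl (sigma : list bool) (y : cantor) : Prop :=
  prefix y (length sigma) = sigma.

(* ---------- Hausdorff measure H^s on 2^omega ----------
   For d(x,y) = 2^{-min{n : x n <> y n}}, every set with >= 2 points has
   diameter 2^{-|sigma|} where sigma is its longest common prefix, and is
   contained in the cylinder [sigma] of the same diameter; hence
   H^s(A) = sup_n inf { sum_i 2^{-s|sigma_i|} : A subset U_i [sigma_i], |sigma_i| >= n }.
   Since this is a supremum of nonnegative infima, H^s(A) = 0 unfolds to: *)
Definition Hs_null (s : R) (A : cls) : Prop :=
  forall (n : nat) (eps : R), (0 < eps)%R ->
    exists sigma : nat -> list bool,
      (forall i, n <= length (sigma i))%nat /\
      (forall y, A y -> exists i, in_cyl (sigma i) y) /\
      exists l : R,
        infinite_sum (fun i => Rpower 2 (- (s * INR (length (sigma i))))) l /\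
        (l < eps)%R.

Definition Hs_pos (s : R) (A : cls) : Prop := ~ Hs_null s A.

(* ---------- Oracle computation (partial recursive functionals) ----------
   Unary mu-recursive functions on nat with Cantor pairing (Stdlib.Arith.Cantor),
   relative to an oracle X : nat -> bool. *)
Inductive pcode : Type :=
| PZero
| PSucc
| PId
| PFst
| PSnd
| POracle
| PComp (f g : pcode)
| PPair (f g : pcode)
| PRec (f g : pcode)
| PMin (f : pcode).

Inductive eval (X : nat -> bool) : pcode -> nat -> nat -> Prop :=
| eZero n : eval X PZero n 0
| eSucc n : eval X PSucc n (S n)
| eId n : eval X PId n n
| eFst n : eval X PFst n (fst (of_nat n))
| eSnd n : eval X PSnd n (snd (of_nat n))
| eOracle n : eval X POracle n (if X n then 1 else 0)
| eComp f g n m v : eval X g n m -> eval X f m v -> eval X (PComp f g) n v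
| ePair f g n v w : eval X f n v -> eval X g n w -> eval X (PPair f g) n (to_nat (v, w))
| eRec0 f g n a v : of_nat n = (a, 0) -> eval X f a v -> eval X (PRec f g) n v
| eRecS f g n a k w v : of_nat n = (a, S k) ->
    eval X (PRec f g) (to_nat (a, k)) w ->
    eval X g (to_nat (a, to_nat (k, w))) v -> eval X (PRec f g) n v
| eMin f n k : eval X f (to_nat (n, k)) 0 ->
    (forall j, j < k -> exists v, eval X f (to_nat (n, j)) (S v)) ->
    eval X (PMin f) n k.

Definition no_oracle : nat -> bool := fun _ => false.

Definition total (X : nat -> bool) (e : pcode) : Prop := forall n, exists v, eval X e n v.

Fixpoint code_bits (l : list bool) : nat :=
  match l with [] => 0 | b :: l' => S (to_nat (if b then 1 else 0, code_bits l')) end.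
Fixpoint code_nats (l : list nat) : nat :=
  match l with [] => 0 | a :: l' => S (to_nat (a, code_nats l')) end.

Definition turing_le (A X : nat -> bool) : Prop :=
  exists e, forall n, eval X e n (if A n then 1 else 0).

Definition Pi01_rel (X : nat -> bool) (P : cls) : Prop :=
  exists e, total X e /\
    forall y, P y <-> forall n, eval X e (code_bits (prefix y n)) 0.

Definition Pi02 (G : cls) : Prop :=
  exists e, total no_oracle e /\
    forall y, G y <-> forall m, exists n, eval no_oracle e (to_nat (m, code_bits (prefix y n))) 0.

(* ---------- Hyperarithmetic sets = Delta^1_1 (Kleene normal form) ---------- *)
Definition Sigma11 (H : nat -> bool) : Prop :=
  exists e, total no_oracle e /\
    forall n, H n = true <->
      exists f : nat -> nat, forall k, eval no_oracle e (to_nat (n, code_nats (prefix f k))) 0.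

Definition Pi11 (H : nat -> bool) : Prop :=
  exists e, total no_oracle e /\
    forall n, H n = true <->
      forall f : nat -> nat, exists k, eval no_oracle e (to_nat (n, code_nats (prefix f k))) 0.

Definition hyperarithmetic (H : nat -> bool) : Prop := Sigma11 H /\ Pi11 H.

(* Main.v *)
(* Fix q with 1/q <= 1-s, and let y be in G when w(i) = y(q i) satisfies a computable list of
   clauses, each of which is a countable disjunction of literals; so G is Pi^0_2. If some w
   satisfies the clauses, then G contains the set of all y with y(q i) = w(i) for all i.
   The uniform measure on this set gives the cylinder of a string of length l at most
   2^(1-sl), whence H^s(G) > 0.

   The clauses say that w codes a relation containing the evaluation relation of all programs
   (and right on total programs), and, for any two programs a, b and any n, a relation M of
   simulation between the nodes of the trees of a and b at n, for which the root of one tree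
   is simulated by the root of the other. Such w exists because the complement of the greatest
   simulation is a simulation in the other direction. Simulation maps paths to paths. If H is
   Delta^1_1, take a and b whose trees at n have a path exactly when n is in H and when n is
   not in H, respectively: then the bit "b is simulated by a at n" must be H(n) in every such w.

   So a nonempty Pi^0_1(x) subclass of G has a constant bit H(n) at a computable position, and
   x finds this bit by compactness. *)
Require Import Defs.
From Stdlib Require Import Reals QArith ZArith List Arith Cantor Lia Lra.
From Stdlib Require Import Classical ClassicalEpsilon.
Import ListNotations.

Local Open Scope nat_scope.

#[local] Arguments to_nat : simpl never.
#[local] Arguments of_nat : simpl never.

(** * Pairing, and single-valuedness of evaluation *)

Definition pr (a b : nat) : nat := to_nat (a, b).
Definition p1 (n : nat) : nat := fst (of_nat n).
Definition p2 (n : nat) : nat := snd (of_nat n).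

Lemma p1_pr a b : p1 (pr a b) = a.
Proof. unfold p1, pr; now rewrite cancel_of_to. Qed.

Lemma p2_pr a b : p2 (pr a b) = b.
Proof. unfold p2, pr; now rewrite cancel_of_to. Qed.

Lemma of_nat_pr a b : of_nat (pr a b) = (a, b).
Proof. apply cancel_of_to. Qed.

Lemma pr_proj n : pr (p1 n) (p2 n) = n.
Proof.
  unfold p1, p2, pr. rewrite <- surjective_pairing. apply cancel_to_of.
Qed.

Lemma pr_le_l a b : a <= pr a b.
Proof. pose proof (to_nat_non_decreasing a b). unfold pr. lia. Qed.

Lemma pr_le_r a b : b <= pr a b.
Proof. pose proof (to_nat_non_decreasing a b). unfold pr. lia. Qed.

Lemma pr_mono a b c d : a <= c -> b <= d -> pr a b <= pr c d.
Proof.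
  intros Hac Hbd. unfold pr.
  pose proof (to_nat_spec a b). pose proof (to_nat_spec c d). nia.
Qed.

Lemma eval_fst X n : eval X PFst n (p1 n).
Proof. constructor. Qed.

Lemma eval_snd X n : eval X PSnd n (p2 n).
Proof. constructor. Qed.

Lemma eval_pair X f g n v w :
  eval X f n v -> eval X g n w -> eval X (PPair f g) n (pr v w).
Proof. apply ePair. Qed.

Lemma eval_rec0 X f g a v : eval X f a v -> eval X (PRec f g) (pr a 0) v.
Proof. intros H. apply eRec0 with (a := a); [apply of_nat_pr | exact H]. Qed.

Lemma eval_recS X f g a k w v :
  eval X (PRec f g) (pr a k) w -> eval X g (pr a (pr k w)) v ->
  eval X (PRec f g) (pr a (S k)) v.
Proof.
  intros Hw Hv. apply eRecS with (a := a) (k := k) (w := w); auto. apply of_nat_pr.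
Qed.

(** Induction on the program. [PRec] calls itself, hence an inner induction on the recursion
    argument; for [PMin] a smaller result would be a zero where the other derivation requires a
    positive value. *)
Lemma eval_det X p : forall n v w, eval X p n v -> eval X p n w -> v = w.
Proof.
  induction p; intros n v w Hv Hw.
  1-6: inversion Hv; inversion Hw; subst; congruence.
  - inversion Hv; inversion Hw; subst. 
    assert (m = m0) by eauto. subst. eauto.
  - inversion Hv; inversion Hw; subst. f_equal. f_equal; eauto.
  - destruct (of_nat n) as [a k] eqn:En.
    revert n v w Hv Hw En. induction k as [|k IH]; intros n v w Hv Hw En.
    + inversion Hv; inversion Hw; subst; try congruence.
      replace a1 with a0 in * by congruence. eauto.
    + inversion Hv; inversion Hw; subst; try congruence.
      replace a1 with a in * by congruence. replace a0 with a in * by congruence.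
      replace k1 with k in * by congruence. replace k0 with k in * by congruence.
      assert (w0 = w1) by (eapply IH; eauto using cancel_of_to).
      subst. eauto.
  - inversion Hv as [| | | | | | | | | | ? ? ? Hv0 Hv1]; 
    inversion Hw as [| | | | | | | | | | ? ? ? Hw0 Hw1]; subst.
    destruct (Nat.lt_trichotomy v w) as [H | [H | H]]; [| exact H |].
    + destruct (Hw1 _ H) as [u Hu]. specialize (IHp _ _ _ Hv0 Hu). discriminate.
    + destruct (Hv1 _ H) as [u Hu]. specialize (IHp _ _ _ Hw0 Hu). discriminate.
Qed.

(** * Computable functions and their closure properties *)

Definition computable (X : nat -> bool) (f : nat -> nat) : Prop :=
  exists e, forall n, eval X e n (f n).

Fixpoint prec (a : nat) (f : nat -> nat -> nat) (k : nat) : nat :=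
  match k with 0 => a | S k => f k (prec a f k) end.

Definition ifz (t a b : nat) : nat := match t with 0 => a | S _ => b end.

Create HintDb comp discriminated.

Section Computable.
Variable X : nat -> bool.

Lemma computable_ext f g : (forall n, f n = g n) -> computable X f -> computable X g.
Proof. intros H [e He]. exists e. intros n. rewrite <- H. apply He. Qed.

Lemma computable_id : computable X (fun n => n).
Proof. exists PId. constructor. Qed.

Lemma computable_comp f g :
  computable X f -> computable X g -> computable X (fun n => f (g n)).
Proof. intros [e He] [d Hd]. exists (PComp e d). intros n. econstructor; eauto. Qed.

Lemma computable_S g : computable X g -> computable X (fun n => S (g n)).
Proof. apply (computable_comp S). exists PSucc. constructor. Qed.

Lemma computable_const c : computable X (fun _ => c).
Proof.
  induction c as [|c IH].
  - exists PZero. constructor.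
  - now apply computable_S.
Qed.

Lemma computable_p1 g : computable X g -> computable X (fun n => p1 (g n)).
Proof. apply (computable_comp p1). exists PFst. constructor. Qed.

Lemma computable_p2 g : computable X g -> computable X (fun n => p2 (g n)).
Proof. apply (computable_comp p2). exists PSnd. constructor. Qed.

Lemma computable_pr f g :
  computable X f -> computable X g -> computable X (fun n => pr (f n) (g n)).
Proof. intros [e He] [d Hd]. exists (PPair e d). intros n. now apply ePair. Qed.

(** The input [n] itself is the parameter handed to [PRec], so base and step may depend on it; the
    last premise is the step on the nested pairs that [PRec] feeds to it. *)
Lemma computable_prec a F k :
  computable X a -> computable X k ->
  computable X (fun m => F (p1 m) (p1 (p2 m)) (p2 (p2 m))) ->
  computable X (fun n => prec (a n) (F n) (k n)).
Proof.
  intros [ea Ha] [ek Hk] [eF HF].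
  exists (PComp (PRec ea eF) (PPair PId ek)). intros n.
  apply eComp with (m := pr n (k n)); [apply ePair; auto; constructor|].
  generalize (k n). intros j. induction j as [|j IH].
  - apply eRec0 with (a := n); [apply of_nat_pr | apply Ha].
  - apply eRecS with (a := n) (k := j) (w := prec (a n) (F n) j).
    + apply of_nat_pr.
    + exact IH.
    + generalize (HF (pr n (pr j (prec (a n) (F n) j)))).
      now rewrite !p1_pr, !p2_pr, p1_pr.
Qed.

End Computable.

Global Opaque pr p1 p2.

#[local] Hint Resolve computable_id computable_S computable_const computable_p1
  computable_p2 computable_pr computable_prec : comp.

Section Computable2.
Variable X : nat -> bool.

Lemma computable_ifz t a b :
  computable X t -> computable X a -> computable X b ->
  computable X (fun n => ifz (t n) (a n) (b n)).
Proof.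
  intros Ht Ha Hb.
  apply computable_ext with (f := fun n => prec (a n) (fun _ _ => b n) (t n)).
  - intros n. now destruct (t n).
  - apply (computable_prec X a (fun n _ _ => b n)); auto.
    apply (computable_comp X b); auto with comp.
Qed.

Lemma computable_pred g : computable X g -> computable X (fun n => pred (g n)).
Proof.
  intros Hg.
  apply computable_ext with (f := fun n => prec 0 (fun j _ => j) (g n)).
  - intros n. now destruct (g n).
  - apply (computable_prec X (fun _ => 0) (fun _ j _ => j)); auto with comp.
Qed.

Lemma computable_add f g :
  computable X f -> computable X g -> computable X (fun n => f n + g n).
Proof.
  intros Hf Hg.
  apply computable_ext with (f := fun n => prec (g n) (fun _ w => S w) (f n)).
  - intros n. induction (f n); simpl; auto.
  - apply (computable_prec X g (fun _ _ w => S w)); auto with comp.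
Qed.

Lemma computable_mul_const q g : computable X g -> computable X (fun n => q * g n).
Proof.
  intros Hg. induction q as [|q IH]; simpl.
  - apply computable_const.
  - now apply computable_add.
Qed.

End Computable2.

#[local] Hint Resolve computable_ifz computable_pred computable_add
  computable_mul_const : comp.

(** With 0 standing for success, this sum serves as a bounded universal quantifier. *)
Definition bsum (F : nat -> nat) (k : nat) : nat := prec 0 (fun j w => F j + w) k.

Lemma bsum_zero F k : bsum F k = 0 <-> forall j, j < k -> F j = 0.
Proof.
  unfold bsum. induction k as [|k IH]; simpl.
  - split; [lia | auto].
  - split.
    + intros H j Hj. destruct (Nat.eq_dec j k) as [->|]; [lia|].
      apply IH; lia.
    + intros H. rewrite (H k) by lia. apply IH. intros; apply H; lia.
Qed.

Lemma computable_bsum X F k :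
  computable X k -> computable X (fun m => F (p1 m) (p2 m)) ->
  computable X (fun n => bsum (F n) (k n)).
Proof.
  intros Hk HF. unfold bsum.
  apply (computable_prec X (fun _ => 0) (fun n j w => F n j + w)); auto with comp.
  apply computable_add; auto with comp.
  apply computable_ext with
    (f := fun m => (fun m => F (p1 m) (p2 m)) (pr (p1 m) (p1 (p2 m)))).
  - intros m. cbv beta. now rewrite p1_pr, p2_pr.
  - apply (computable_comp X (fun m => F (p1 m) (p2 m))); auto with comp.
Qed.

(** * Lists as numbers *)

Definition consc (a c : nat) : nat := S (pr a c).
Definition headc (c : nat) : nat := p1 (pred c).
Definition tailc (c : nat) : nat := p2 (pred c).
Definition dropc (k c : nat) : nat := prec c (fun _ w => tailc w) k.
(** Counts the nonempty tails; the bound [c] is large enough because a list is no longer than its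
    code. *)
Definition lenc (c : nat) : nat := bsum (fun j => ifz (dropc j c) 0 1) c.

(* The state of the loop is the pair of the remaining list and the accumulator. *)
Definition revstep (st : nat) : nat :=
  ifz (p1 st) st (pr (tailc (p1 st)) (consc (headc (p1 st)) (p2 st))).
Definition revc (c : nat) : nat := p2 (prec (pr c 0) (fun _ w => revstep w) c).

Section ListComputable.
Variable X : nat -> bool.

Lemma computable_consc f g :
  computable X f -> computable X g -> computable X (fun n => consc (f n) (g n)).
Proof. intros. unfold consc. auto with comp. Qed.

Lemma computable_headc g : computable X g -> computable X (fun n => headc (g n)).
Proof. intros. unfold headc. auto with comp. Qed.

Lemma computable_tailc g : computable X g -> computable X (fun n => tailc (g n)).
Proof. intros. unfold tailc. auto with comp. Qed.

Lemma computable_dropc f g :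
  computable X f -> computable X g -> computable X (fun n => dropc (f n) (g n)).
Proof.
  intros. unfold dropc.
  apply (computable_prec X g (fun _ _ w => tailc w)); auto.
  apply computable_tailc; auto with comp.
Qed.

Lemma computable_lenc g : computable X g -> computable X (fun n => lenc (g n)).
Proof.
  apply computable_comp. unfold lenc.
  apply (computable_bsum X (fun n j => ifz (dropc j n) 0 1)); auto with comp.
  apply computable_ifz; auto using computable_dropc with comp.
Qed.

Lemma computable_revc g : computable X g -> computable X (fun n => revc (g n)).
Proof.
  apply computable_comp. unfold revc. apply computable_p2.
  apply (computable_prec X (fun c => pr c 0) (fun _ _ w => revstep w)); auto with comp.
  unfold revstep.
  auto 20 using computable_tailc, computable_headc, computable_consc with comp.
Qed.

End ListComputable.

#[local] Hint Resolve computable_consc computable_headc computable_tailc computable_dropc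
  computable_lenc computable_revc : comp.

Lemma code_nats_cons a l : code_nats (a :: l) = consc a (code_nats l).
Proof. reflexivity. Qed.

Lemma headc_consc a c : headc (consc a c) = a.
Proof. apply p1_pr. Qed.

Lemma tailc_consc a c : tailc (consc a c) = c.
Proof. apply p2_pr. Qed.

Definition bit (b : bool) : nat := if b then 1 else 0.

Lemma code_bits_nats l : code_bits l = code_nats (map bit l).
Proof.
  induction l as [|b l IH]; [reflexivity|].
  cbn [code_bits code_nats map]. now rewrite IH.
Qed.

Lemma code_nats_length l : length l <= code_nats l.
Proof.
  induction l as [|a l IH]; simpl; [lia|].
  pose proof (pr_le_r a (code_nats l)).
  change (to_nat (a, code_nats l)) with (pr a (code_nats l)). lia.
Qed.

Lemma tailc_nats l : tailc (code_nats l) = code_nats (tl l).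
Proof.
  destruct l as [|a l]; [reflexivity |].
  rewrite code_nats_cons. apply tailc_consc.
Qed.

Lemma dropc_nats k l : dropc k (code_nats l) = code_nats (skipn k l).
Proof.
  unfold dropc. induction k as [|k IH]; simpl prec; [reflexivity|].
  rewrite IH, tailc_nats. f_equal. clear.
  revert l. induction k as [|k IH]; intros [|a l]; simpl; auto.
Qed.

Lemma lenc_nats l : lenc (code_nats l) = length l.
Proof.
  assert (H : forall k, bsum (fun j => ifz (dropc j (code_nats l)) 0 1) k
                        = Nat.min k (length l)).
  { intros k. induction k as [|k IH]; [reflexivity|].
    unfold bsum in *. simpl prec. rewrite IH, dropc_nats.
    pose proof (length_skipn k l) as Hl.
    destruct (skipn k l) as [|b m]; cbn [length ifz code_nats] in *; lia. }
  unfold lenc. rewrite H. pose proof (code_nats_length l). lia.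
Qed.

(** [prec] adds its rounds at the end, whereas an induction on a list consumes the first round. *)
Lemma prec_iter_shift f a k :
  prec a (fun _ w => f w) (S k) = prec (f a) (fun _ w => f w) k.
Proof. induction k as [|k IH]; simpl in *; congruence. Qed.

(** The number of rounds is the code, which may exceed the length; surplus rounds fix the state,
    whence the generalisation to every [k] at least the length. *)
Lemma revc_nats l : revc (code_nats l) = code_nats (rev l).
Proof.
  assert (H : forall k l m, length l <= k ->
     prec (pr (code_nats l) (code_nats m)) (fun _ w => revstep w) k
     = pr 0 (code_nats (rev l ++ m))).
  { assert (Hstop : forall k c,
      prec (pr 0 c) (fun _ w => revstep w) k = pr 0 c).
    { intros k c. induction k as [|k IH]; [reflexivity|]. simpl. rewrite IH.
      unfold revstep. now rewrite p1_pr. }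
    induction k as [|k IH]; intros [|a l'] m Hk; try apply Hstop; [simpl in Hk; lia|].
    rewrite prec_iter_shift. unfold revstep at 1.
    rewrite p1_pr, p2_pr, code_nats_cons, headc_consc, tailc_consc.
    cbn [ifz consc]. rewrite <- code_nats_cons, IH by (simpl in Hk; lia).
    simpl rev. now rewrite <- app_assoc. }
  unfold revc. change 0 with (code_nats []) at 1.
  rewrite H by apply code_nats_length. now rewrite p2_pr, app_nil_r.
Qed.

(** * Prefixes, dependent choice and compactness *)

Lemma prefix_S {A} (y : nat -> A) n : prefix y (S n) = prefix y n ++ [y n].
Proof. unfold prefix. now rewrite seq_S, map_app. Qed.

Lemma prefix_length {A} (y : nat -> A) n : length (prefix y n) = n.
Proof. unfold prefix. now rewrite length_map, length_seq. Qed.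

Lemma skipn_prefix {A} (y : nat -> A) k n :
  k < n -> exists l, skipn k (prefix y n) = y k :: l.
Proof.
  intros H. unfold prefix. rewrite skipn_map, skipn_seq.
  destruct (n - k) as [|m] eqn:E; [lia|]. simpl. eauto.
Qed.

(** Dependent choice: [U] is the invariant that keeps a string extendible, [C] the condition on the
    symbol appended to it. *)
Lemma path_exists {A} (U : list A -> Prop) (C : list A -> A -> Prop) :
  U [] -> (forall t, U t -> exists a, C t a /\ U (t ++ [a])) ->
  exists y, forall n, U (prefix y n) /\ C (prefix y n) (y n).
Proof.
  intros H0 HS.
  destruct (HS [] H0) as [a0 _].
  assert (Hch : forall t, exists a, U t -> C t a /\ U (t ++ [a])).
  { intros t. destruct (classic (U t)) as [Ht|Ht].
    - destruct (HS t Ht) as [a Ha]. eauto.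
    - exists a0. tauto. }
  set (ch := fun t => proj1_sig (constructive_indefinite_description _ (Hch t))).
  assert (Hc : forall t, U t -> C t (ch t) /\ U (t ++ [ch t])).
  { intros t. exact (proj2_sig (constructive_indefinite_description _ (Hch t))). }
  set (L := fix L n := match n with 0 => [] | S n => L n ++ [ch (L n)] end).
  exists (fun n => ch (L n)).
  assert (HL : forall n, prefix (fun n => ch (L n)) n = L n).
  { induction n as [|n IH]; [reflexivity|]. now rewrite prefix_S, IH. }
  assert (HU : forall n, U (L n)).
  { induction n as [|n IH]; [exact H0|]. now apply Hc. }
  intros n. rewrite HL. split; [apply HU | now apply Hc].
Qed.

(** Compactness of Cantor space. If no bound works for all points through a string, then none works
    for one of its two extensions; the resulting path would avoid [D]. *)
Lemma fan (D : list bool -> Prop) :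
  (forall y, exists n, D (prefix y n)) ->
  exists L, forall y, exists n, n <= L /\ D (prefix y n).
Proof.
  intros Hbar. apply NNPP. intros Hno.
  set (U := fun t => forall L, exists y, prefix y (length t) = t /\
                       forall n, n <= L -> ~ D (prefix y n)).
  destruct (path_exists U (fun _ _ => True)) as [y Hy].
  - intros L. apply NNPP. intros H. apply Hno. exists L. intros y.
    apply NNPP. intros Hn. apply H. exists y. split; [reflexivity|].
    intros n Hle Hd. apply Hn. eauto.
  - intros t Ht. apply NNPP. intros H.
    assert (Hb : forall b, exists L, forall y, prefix y (S (length t)) = t ++ [b] ->
                   exists n, n <= L /\ D (prefix y n)).
    { intros b. apply NNPP. intros Hb. apply H. exists b. split; [trivial|].
      intros L. apply NNPP. intros HL. apply Hb. exists L. intros y Hy.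
      apply NNPP. intros Hn. apply HL. exists y. split.
      - now rewrite length_app, Nat.add_1_r.
      - intros n Hle Hd. apply Hn. eauto. }
    destruct (Hb true) as [L1 H1], (Hb false) as [L2 H2].
    destruct (Ht (L1 + L2)) as (y & Hy & Hn).
    assert (Hyt : prefix y (S (length t)) = t ++ [y (length t)])
      by (now rewrite prefix_S, Hy).
    destruct (y (length t)).
    + destruct (H1 _ Hyt) as (n & Hle & Hd). apply (Hn n); auto; lia.
    + destruct (H2 _ Hyt) as (n & Hle & Hd). apply (Hn n); auto; lia.
  - destruct (Hbar y) as [n Hn]. destruct (Hy n) as [HU _].
    destruct (HU n) as (z & Hz & Hd). rewrite prefix_length in Hz.
    apply (Hd n); auto. now rewrite Hz.
Qed.

(** * Classes given by infinite conjunctions of clauses *)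

Definition nz (n : nat) : bool := match n with 0 => false | S _ => true end.

(* The number [pr i c] stands for the literal "bit [i] is [nz c]". *)
Definition holds (w : nat -> bool) (lit : nat) : Prop := w (p1 lit) = nz (p2 lit).

Definition sat (lits : nat -> nat -> nat) (w : nat -> bool) : Prop :=
  forall m, exists z, holds w (lits m z).

Definition sparse (q : nat) (y : cantor) : nat -> bool := fun i => y (q * i).

Lemma sparse_sat_Pi02 q lits :
  computable no_oracle (fun n => lits (p1 n) (p2 n)) ->
  Pi02 (fun y => sat lits (sparse q y)).
Proof.
  intros Hlits.
  (* [z] is read off the length of the prefix, which can be taken arbitrarily large *)
  set (lit := fun n => lits (p1 n) (p1 (lenc (p2 n)))).
  set (rest := fun n => dropc (q * p1 (lit n)) (p2 n)).
  (* [rest] is 0 when the prefix ends before the bit in question, and the check then fails. *)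
  set (chk := fun n => ifz (rest n) 1
     (ifz (p2 (lit n)) (headc (rest n)) (ifz (headc (rest n)) 1 0))).
  assert (Hlit : computable no_oracle lit).
  { apply computable_ext with
      (f := fun n => (fun m => lits (p1 m) (p2 m)) (pr (p1 n) (p1 (lenc (p2 n))))).
    - intros n. cbv beta. now rewrite p1_pr, p2_pr.
    - apply (computable_comp _ (fun m => lits (p1 m) (p2 m))); auto with comp. }
  assert (Hrest : computable no_oracle rest) by (unfold rest; auto with comp).
  assert (Hchk : computable no_oracle chk) by (unfold chk; auto with comp).
  assert (Hval : forall y m n, chk (pr m (code_bits (prefix y n))) = 0 <->
     q * p1 (lits m (p1 n)) < n /\ holds (sparse q y) (lits m (p1 n))).
  { intros y m n. unfold chk, rest, lit, holds, sparse.
    rewrite p1_pr, p2_pr, code_bits_nats, lenc_nats, length_map, prefix_length.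
    set (l := lits m (p1 n)). rewrite dropc_nats, skipn_map.
    destruct (lt_dec (q * p1 l) n) as [Hlt|Hge].
    - destruct (skipn_prefix y _ _ Hlt) as [r ->].
      cbn [map]. rewrite code_nats_cons, headc_consc. unfold consc. cbn [ifz].
      destruct (y (q * p1 l)), (p2 l); simpl; intuition congruence.
    - rewrite skipn_all2 by (rewrite prefix_length; lia). simpl.
      split; [discriminate | tauto]. }
  destruct Hchk as [e He]. exists e. split.
  - intros n. exists (chk n). apply He.
  - intros y. split; intros H m; destruct (H m) as [z Hz].
    (* This length encodes [z] and, a pair being at least its second component, exceeds the position
       of the bit. *)
    + set (n := pr z (S (q * p1 (lits m z)))). exists n.
      change (to_nat (m, ?c)) with (pr m c).
      assert (E : chk (pr m (code_bits (prefix y n))) = 0).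
      { apply Hval. unfold n at 1 3. rewrite !p1_pr. split; [|exact Hz].
        apply pr_le_r. }
      rewrite <- E. apply He.
    + exists (p1 z). apply Hval.
      exact (eval_det _ _ _ _ _ (He _) Hz).
Qed.

(** * Hausdorff measure *)

(** Counts the unconstrained positions below [n] when the bits at multiples of [q] are
    prescribed. *)
Fixpoint free (q n : nat) : nat :=
  match n with
  | 0 => 0
  | S n => if n mod q =? 0 then free q n else S (free q n)
  end.

Lemma free_bound q n : 0 < q -> q * n <= q * free q n + n + q.
Proof.
  intros Hq.
  (* The quotient is n/q rounded up, the number of multiples of [q] below [n]. *)
  assert (H : free q n + (n + (q - 1)) / q = n).
  { induction n as [|n IH].
    - simpl. apply Nat.div_small. lia.
    - simpl free. pose proof (Nat.div_mod_eq n q) as E.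
      pose proof (Nat.mod_upper_bound n q ltac:(lia)) as Hr.
      set (k := n / q) in *. set (r := n mod q) in *.
      destruct (Nat.eqb_spec r 0) as [Hr0|Hr0].
      + assert (E1 : (n + (q - 1)) / q = k)
          by (symmetry; apply Nat.div_unique with (r := q - 1); lia).
        assert (E2 : (S n + (q - 1)) / q = k + 1)
          by (symmetry; apply Nat.div_unique with (r := 0); lia).
        lia.
      + assert (E1 : (n + (q - 1)) / q = k + 1)
          by (symmetry; apply Nat.div_unique with (r := r - 1); lia).
        assert (E2 : (S n + (q - 1)) / q = k + 1)
          by (symmetry; apply Nat.div_unique with (r := r); lia).
        lia. }
  pose proof (Nat.Div0.mul_div_le (n + (q - 1)) q). nia.
Qed.

Local Open Scope R_scope.

(** The uniform measure, on the set with prescribed bits at multiples of [q], of a cylinder of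
    length [n] meeting that set. *)
Definition weight (q n : nat) : R := (/ 2) ^ free q n.

Lemma weight_pos q n : 0 < weight q n.
Proof. apply pow_lt. lra. Qed.

(** By [free_bound] and the choice of [q], [free q n] is at least sn - 1; the lost 1 becomes the
    factor 2. *)
Lemma weight_le (s : R) (q n : nat) :
  (0 < q)%nat -> INR q * s <= INR q - 1 ->
  weight q n <= 2 * Rpower 2 (- (s * INR n)).
Proof.
  intros Hq Hs. unfold weight.
  rewrite pow_inv, <- Rpower_pow, <- Rpower_Ropp by lra.
  rewrite <- (Rpower_1 2) at 2 by lra. rewrite <- Rpower_plus.
  apply Rle_Rpower; [lra|].
  pose proof (le_INR _ _ (free_bound q n Hq)) as H.
  rewrite !plus_INR, !mult_INR in H.
  assert (0 < INR q) by now apply lt_0_INR.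
  pose proof (pos_INR n).
  assert (INR q * (s * INR n) <= INR q * (INR (free q n) + 1)) by nra.
  assert (s * INR n <= INR (free q n) + 1) by (eapply Rmult_le_reg_l; eauto).
  lra.
Qed.

Definition extends (t u : list bool) : bool :=
  if list_eq_dec Bool.bool_dec (firstn (length t) u) t then true else false.

Lemma extends_refl t : extends t t = true.
Proof.
  unfold extends. rewrite firstn_all. now destruct (list_eq_dec _ t t).
Qed.

(** The default [negb b] makes the last equation also record that [u] is long enough to have a bit
    there. *)
Lemma extends_snoc t b u :
  extends (t ++ [b]) u = true -> extends t u = true /\ nth (length t) u (negb b) = b.
Proof.
  unfold extends. rewrite length_app, Nat.add_1_r.
  destruct (list_eq_dec _ _ (t ++ [b])) as [E|]; [intros _ | discriminate].
  assert (Et : firstn (length t) u = t).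
  { transitivity (firstn (length t) (firstn (S (length t)) u)).
    - rewrite firstn_firstn. f_equal. lia.
    - now rewrite E, firstn_app, Nat.sub_diag, firstn_all, app_nil_r. }
  split; [now destruct (list_eq_dec _ _ t)|].
  rewrite <- (firstn_skipn (S (length t)) u), E, <- app_assoc.
  apply nth_middle.
Qed.

Section Frostman.
Variables (q : nat) (sigma : nat -> list bool).

Definition mass (t : list bool) (i : nat) : R :=
  if extends t (sigma i) then weight q (length (sigma i)) else 0.

Lemma mass_nonneg t i : 0 <= mass t i.
Proof.
  unfold mass. pose proof (weight_pos q (length (sigma i))).
  destruct (extends _ _); lra.
Qed.

Lemma mass_split t i : mass (t ++ [true]) i + mass (t ++ [false]) i <= mass t i.
Proof.
  unfold mass. pose proof (weight_pos q (length (sigma i))).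
  pose proof (extends_snoc t true (sigma i)) as Ht.
  pose proof (extends_snoc t false (sigma i)) as Hf.
  destruct (extends (t ++ [true]) _), (extends (t ++ [false]) _);
    try destruct (Ht eq_refl) as [Et Nt]; try destruct (Hf eq_refl) as [Ef Nf].
  - exfalso. simpl in *.
    destruct (le_lt_dec (length (sigma i)) (length t)) as [Hl|Hl].
    + rewrite nth_overflow in Nt by exact Hl. discriminate.
    + rewrite nth_indep with (d' := true) in Nt by exact Hl. congruence.
  - rewrite Et. lra.
  - rewrite Ef. lra.
  - destruct (extends t _); lra.
Qed.

Lemma mass_split_sum t N :
  sum_f_R0 (mass (t ++ [true])) N + sum_f_R0 (mass (t ++ [false])) N
  <= sum_f_R0 (mass t) N.
Proof.
  rewrite <- plus_sum. apply sum_Rle. intros i _. apply mass_split.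
Qed.

Lemma mass_sum_mono t N M : (N <= M)%nat ->
  sum_f_R0 (mass t) N <= sum_f_R0 (mass t) M.
Proof.
  induction 1 as [|M _ IH]; [lra|]. simpl. pose proof (mass_nonneg t (S M)). lra.
Qed.

(** The covering cylinders inside that of [t] weigh too little in total to cover it. One constant
    below the weight bounds all partial sums, so no limit has to be taken. *)
Definition light (t : list bool) : Prop :=
  exists c, c < weight q (length t) /\ forall N, sum_f_R0 (mass t) N <= c.

(** At a multiple of [q] the weight does not drop, so both children stay light and the bit can be
    prescribed. *)
Lemma light_child t b : light t -> length t mod q = 0%nat -> light (t ++ [b]).
Proof.
  intros (c & Hc & HN) Hq. exists c. split.
  - rewrite length_app, Nat.add_1_r. unfold weight in *. simpl. now rewrite Hq.
  - intros N. specialize (HN N). pose proof (mass_split_sum t N).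
    pose proof (cond_pos_sum _ N (mass_nonneg (t ++ [true]))).
    pose proof (cond_pos_sum _ N (mass_nonneg (t ++ [false]))).
    destruct b; lra.
Qed.

(** Here the weight halves, while the masses of the two children add up to at most that of [t]. *)
Lemma light_some_child t :
  light t -> length t mod q <> 0%nat -> exists b, light (t ++ [b]).
Proof.
  intros (c & Hc & HN) Hq. apply NNPP. intros Hno.
  assert (Hheavy : forall b, exists N, c / 2 < sum_f_R0 (mass (t ++ [b])) N).
  { intros b. apply NNPP. intros Hb. apply Hno. exists b. exists (c / 2). split.
    - rewrite length_app, Nat.add_1_r. unfold weight in *. simpl.
      destruct (Nat.eqb_spec (length t mod q) 0) as [|_]; [contradiction|]. simpl. lra.
    - intros N. apply Rnot_lt_le. intros H. apply Hb. eauto. }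
  destruct (Hheavy true) as [N1 H1], (Hheavy false) as [N2 H2].
  pose proof (mass_sum_mono (t ++ [true]) N1 (N1 + N2) ltac:(lia)).
  pose proof (mass_sum_mono (t ++ [false]) N2 (N1 + N2) ltac:(lia)).
  pose proof (mass_split_sum t (N1 + N2)). specialize (HN (N1 + N2)%nat). lra.
Qed.

(** A covering string equal to [t] would contribute the full weight of [t] by itself. *)
Lemma light_avoids t i : light t -> sigma i <> t.
Proof.
  intros (c & Hc & HN) E. specialize (HN i).
  assert (Hi : sum_f_R0 (mass t) i >= mass t i).
  { destruct i as [|i]; simpl; [lra|].
    pose proof (cond_pos_sum _ i (mass_nonneg t)). lra. }
  unfold mass at 2 in Hi. rewrite E, extends_refl in Hi. lra.
Qed.

End Frostman.

(** A mass distribution argument without a measure: a path of light strings obeying [w] at multiples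
    of [q] gives a point of [A] that no covering cylinder contains. *)
Lemma sparse_Hs_pos (s : R) (q : nat) (w : nat -> bool) (A : cls) :
  (0 < q)%nat -> INR q * s <= INR q - 1 ->
  (forall y, (forall i, sparse q y i = w i) -> A y) -> Hs_pos s A.
Proof.
  intros Hq Hs HA Hnull.
  (* With the factor 2 of [weight_le], a total below 1/2 stays below 1, the weight of the empty
     string, which is therefore light. *)
  destruct (Hnull 0%nat (/ 2) ltac:(lra)) as (sigma & _ & Hcov & l & Hl & Hlt).
  set (term := fun i => Rpower 2 (- (s * INR (length (sigma i))))) in *.
  destruct (path_exists (light q sigma)
    (fun t b => length t mod q = 0%nat -> b = w (length t / q)%nat)) as [y Hy].
  - exists (2 * l). split; [unfold weight; simpl; lra|].
    intros N. apply Rle_trans with (2 * sum_f_R0 term N).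
    + rewrite scal_sum. apply sum_Rle. intros i _.
      unfold mass. simpl. rewrite (Rmult_comm _ 2). now apply weight_le.
    + apply Rmult_le_compat_l; [lra|]. apply sum_incr; [exact Hl|].
      intros i. left. apply exp_pos.
  - intros t Ht. destruct (Nat.eq_dec (length t mod q) 0) as [E|E].
    + exists (w (length t / q)%nat). split; [auto | now apply light_child].
    + destruct (light_some_child _ _ _ Ht E) as [b Hb]. exists b. tauto.
  - assert (HAy : A y).
    { apply HA. intros i. destruct (Hy (q * i)%nat) as [_ H].
      unfold sparse. rewrite H, prefix_length.
      - now rewrite Nat.mul_comm, Nat.div_mul by lia.
      - rewrite prefix_length, Nat.mul_comm. apply Nat.Div0.mod_mul. }
    destruct (Hcov y HAy) as [i Hi]. destruct (Hy (length (sigma i))) as [H _].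
    apply (light_avoids _ _ _ i H). now symmetry.
Qed.

(** The empty class is null: strings of lengths [N + i] give a geometric series with sum r^N/(1-r),
    which is arbitrarily small. *)
Lemma Hs_pos_inhabited (s : R) (A : cls) : 0 < s -> Hs_pos s A -> exists y, A y.
Proof.
  intros Hs Hpos. apply NNPP. intros Hempty. apply Hpos. intros n eps Heps.
  set (r := Rpower 2 (- s)).
  assert (Hr0 : 0 < r) by apply exp_pos.
  assert (Hr1 : r < 1).
  { unfold r. rewrite <- (Rpower_O 2) by lra. apply Rpower_lt; lra. }
  assert (Hrabs : Rabs r < 1) by (rewrite Rabs_right; lra).
  assert (Hterm : forall k, Rpower 2 (- (s * INR k)) = r ^ k).
  { intros k. unfold r. rewrite <- Rpower_pow by apply exp_pos.
    rewrite Rpower_mult. f_equal. ring. }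
  destruct (pow_lt_1_zero r Hrabs (eps * (1 - r)) ltac:(nra)) as [K HK].
  set (N := (n + K)%nat).
  exists (fun i => repeat true (N + i)). split; [|split].
  - intros i. rewrite repeat_length. unfold N. lia.
  - intros y Hy. exfalso. eauto.
  - exists (r ^ N * / (1 - r)). split.
    + intros e He. pose proof (GP_infinite r Hrabs) as HG.
      assert (HN0 : 0 < r ^ N) by now apply pow_lt.
      destruct (HG (e / r ^ N)) as [M HM]; [apply Rdiv_lt_0_compat; lra|].
      exists M. intros m Hm. specialize (HM m Hm).
      unfold Rdist in *.
      replace (sum_f_R0 _ m) with (r ^ N * sum_f_R0 (fun k => 1 * r ^ k) m).
      * rewrite <- Rmult_minus_distr_l, Rabs_mult, (Rabs_right (r ^ N)) by lra.
        apply Rmult_lt_reg_l with (/ r ^ N); [now apply Rinv_0_lt_compat|].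
        rewrite <- Rmult_assoc, Rinv_l by lra. unfold Rdiv in HM. lra.
      * rewrite scal_sum. apply sum_eq. intros i _.
        rewrite repeat_length, Hterm, pow_add. ring.
    + specialize (HK N ltac:(unfold N; lia)).
      rewrite Rabs_right in HK by (left; now apply pow_lt).
      apply Rmult_lt_reg_r with (1 - r); [lra|].
      rewrite Rmult_assoc, Rinv_l by lra. lra.
Qed.

Local Close Scope R_scope.

(** * The clauses *)

Definition rI (c n v : nat) : nat := pr 0 (pr c (pr n v)).
Definition bI (f n k : nat) : nat := pr 1 (pr f (pr n k)).
Definition mI (a b n s r : nat) : nat := pr 2 (pr a (pr b (pr n (pr s r)))).

Definition pos (i : nat) : nat := pr i 1.
Definition neg (i : nat) : nat := pr i 0.

(** All indices from 2 on belong to the conclusion, which may thus be a countable disjunction;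
    [pred (pred z)] in the rules undoes this shift. A single premise is entered twice. *)
Definition horn (h1 h2 : nat) (concl z : nat) : nat :=
  ifz z (neg h1) (ifz (pred z) (neg h2) concl).

Definition kComp (f g : nat) : nat := pr 6 (pr f g).
Definition kPair (f g : nat) : nat := pr 7 (pr f g).
Definition kRec (f g : nat) : nat := pr 8 (pr f g).
Definition kMin (f : nat) : nat := pr 9 f.

Fixpoint code_of (p : pcode) : nat :=
  match p with
  | PZero => pr 0 0
  | PSucc => pr 1 0
  | PId => pr 2 0
  | PFst => pr 3 0
  | PSnd => pr 4 0
  | POracle => pr 5 0
  | PComp f g => kComp (code_of f) (code_of g)
  | PPair f g => kPair (code_of f) (code_of g)
  | PRec f g => kRec (code_of f) (code_of g)
  | PMin f => kMin (code_of f)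
  end.

Definition a0 (p : nat) : nat := p1 p.
Definition a1 (p : nat) : nat := p1 (p2 p).
Definition a2 (p : nat) : nat := p1 (p2 (p2 p)).
Definition a3 (p : nat) : nat := p1 (p2 (p2 (p2 p))).
Definition a4 (p : nat) : nat := p1 (p2 (p2 (p2 (p2 p)))).
Definition a5 (p : nat) : nat := p1 (p2 (p2 (p2 (p2 (p2 p))))).

Definition tuple (x0 x1 x2 x3 x4 x5 : nat) : nat :=
  pr x0 (pr x1 (pr x2 (pr x3 (pr x4 (pr x5 0))))).

Lemma tuple_proj x0 x1 x2 x3 x4 x5 (t := tuple x0 x1 x2 x3 x4 x5) :
  a0 t = x0 /\ a1 t = x1 /\ a2 t = x2 /\ a3 t = x3 /\ a4 t = x4 /\ a5 t = x5.
Proof.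
  unfold t, tuple, a0, a1, a2, a3, a4, a5. now rewrite ?p2_pr, ?p1_pr.
Qed.

(* Nodes of trees are reversed lists, so that a child of [s] is [consc v s]. *)
Definition nodeI (a n s : nat) : nat := rI a (pr n (revc s)) 0.

(* For each rule [F] and parameters [p] there is one clause, with literals [F p z], z in nat.
   The bits [rI], [bI], [mI] stand for: the value of [c] at [n] is [v]; [f] is positive
   on [pr n j] for all [j < k]; the subtree above [s] in the tree of [a] is simulated by the
   subtree above [r] in the tree of [b]. *)
Definition rules : list (nat -> nat -> nat) :=
  [ (fun p _ => pos (rI (pr 0 0) p 0));
    (fun p _ => pos (rI (pr 1 0) p (S p)));
    (fun p _ => pos (rI (pr 2 0) p p));
    (fun p _ => pos (rI (pr 3 0) p (p1 p)));
    (fun p _ => pos (rI (pr 4 0) p (p2 p)));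
    (fun p _ => pos (rI (pr 5 0) p 0));
    (fun p z => horn (rI (a1 p) (a2 p) (a3 p)) (rI (a0 p) (a3 p) (a4 p))
      (pos (rI (kComp (a0 p) (a1 p)) (a2 p) (a4 p))) z);
    (fun p z => horn (rI (a0 p) (a2 p) (a3 p)) (rI (a1 p) (a2 p) (a4 p))
      (pos (rI (kPair (a0 p) (a1 p)) (a2 p) (pr (a3 p) (a4 p)))) z);
    (fun p z => horn (rI (a0 p) (a2 p) (a3 p)) (rI (a0 p) (a2 p) (a3 p))
      (pos (rI (kRec (a0 p) (a1 p)) (pr (a2 p) 0) (a3 p))) z);
    (fun p z => horn (rI (kRec (a0 p) (a1 p)) (pr (a2 p) (a3 p)) (a4 p))
      (rI (a1 p) (pr (a2 p) (pr (a3 p) (a4 p))) (a5 p))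
      (pos (rI (kRec (a0 p) (a1 p)) (pr (a2 p) (S (a3 p))) (a5 p))) z);
    (fun p _ => pos (bI (a0 p) (a1 p) 0));
    (fun p z => horn (bI (a0 p) (a1 p) (a2 p)) (rI (a0 p) (pr (a1 p) (a2 p)) (S (a3 p)))
      (pos (bI (a0 p) (a1 p) (S (a2 p)))) z);
    (fun p z => horn (bI (a0 p) (a1 p) (a2 p)) (rI (a0 p) (pr (a1 p) (a2 p)) 0)
      (pos (rI (kMin (a0 p)) (a1 p) (a2 p))) z);
    (fun p z => horn (rI (a0 p) (a1 p) 0) (rI (a0 p) (a1 p) 0)
      (neg (rI (a0 p) (a1 p) (S (a2 p)))) z);
    (fun p z => horn (mI (a0 p) (a1 p) (a2 p) (a3 p) (a4 p)) (nodeI (a0 p) (a2 p) (a3 p))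
      (pos (nodeI (a1 p) (a2 p) (a4 p))) z);
    (fun p z => horn (mI (a0 p) (a1 p) (a2 p) (a3 p) (a4 p)) (nodeI (a0 p) (a2 p) (a3 p))
      (pos (mI (a0 p) (a1 p) (a2 p) (consc (a5 p) (a3 p)) (consc (pred (pred z)) (a4 p)))) z);
    (fun p z => pos (ifz z (mI (a0 p) (a1 p) (a2 p) 0 0) (mI (a1 p) (a0 p) (a2 p) 0 0))) ].

(** The default repeats the first entry of [rules], so an index past the end adds no new clause. *)
Definition select (l : list (nat -> nat -> nat)) (i : nat) : nat -> nat -> nat :=
  nth i l (fun p _ => pos (rI (pr 0 0) p 0)).

Definition lits (m z : nat) : nat := select rules (p1 m) (p2 m) z.

Lemma lits_computable X : computable X (fun n => lits (p1 n) (p2 n)).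
Proof.
  assert (Hd : computable X (fun n => pos (rI (pr 0 0) (p1 n) 0)))
    by (unfold pos, rI; auto 20 with comp).
  assert (Hr : Forall (fun F => computable X (fun n => F (p1 n) (p2 n))) rules).
  { unfold rules, horn, nodeI, pos, neg, rI, bI, mI, kComp, kPair, kRec, kMin,
      a0, a1, a2, a3, a4, a5.
    repeat (apply Forall_cons; [auto 40 with comp|]). apply Forall_nil. }
  assert (H : forall l, Forall (fun F => computable X (fun n => F (p1 n) (p2 n))) l ->
     computable X (fun n => select l (p1 n) (p1 (p2 n)) (p2 (p2 n)))).
  { induction 1 as [|F l HF _ IH].
    - apply computable_ext with (f := fun n => pos (rI (pr 0 0) (p1 (p2 n)) 0)).
      + intros n. unfold select. now destruct (p1 n).
      + apply (computable_comp X (fun n => pos (rI (pr 0 0) (p1 n) 0))); auto with comp.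
    - apply computable_ext with (f := fun n => ifz (p1 n) (F (p1 (p2 n)) (p2 (p2 n)))
        (select l (pred (p1 n)) (p1 (p2 n)) (p2 (p2 n)))).
      + intros n. now destruct (p1 n).
      + apply computable_ifz; auto with comp.
        * apply (computable_comp X (fun n => F (p1 n) (p2 n))); auto with comp.
        * apply computable_ext with (f := fun n =>
            (fun n => select l (p1 n) (p1 (p2 n)) (p2 (p2 n))) (pr (pred (p1 n)) (p2 n))).
          -- intros n. cbv beta. now rewrite p1_pr, p2_pr.
          -- apply (computable_comp X
               (fun n => select l (p1 n) (p1 (p2 n)) (p2 (p2 n)))); auto with comp. }
  specialize (H _ Hr).
  apply computable_ext with (f := fun n =>
    (fun n => select rules (p1 n) (p1 (p2 n)) (p2 (p2 n)))
      (pr (p1 (p1 n)) (pr (p2 (p1 n)) (p2 n)))).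
  - intros n. cbv beta. now rewrite ?p1_pr, ?p2_pr, ?p1_pr, ?p2_pr.
  - apply (computable_comp X
      (fun n => select rules (p1 n) (p1 (p2 n)) (p2 (p2 n)))); auto 20 with comp.
Qed.

(** * Models of the clauses *)

Definition on (w : nat -> bool) (i : nat) : Prop := w i = true.

Lemma holds_pos w i : holds w (pos i) <-> on w i.
Proof. unfold holds, pos, on. now rewrite p1_pr, p2_pr. Qed.

Lemma holds_neg w i : holds w (neg i) <-> ~ on w i.
Proof.
  unfold holds, neg, on. rewrite p1_pr, p2_pr. simpl. now rewrite Bool.not_true_iff_false.
Qed.

Lemma horn_iff w h1 h2 c :
  (exists z, holds w (horn h1 h2 (c z) z)) <->
  (on w h1 -> on w h2 -> exists z, holds w (c (S (S z)))).
Proof.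
  split.
  - intros [[|[|z]] Hz] H1 H2; simpl in Hz.
    + now apply holds_neg in Hz.
    + now apply holds_neg in Hz.
    + eauto.
  - intros H. destruct (classic (on w h1)) as [H1|H1]; [|exists 0; now apply holds_neg].
    destruct (classic (on w h2)) as [H2|H2]; [|exists 1; now apply holds_neg].
    destruct (H H1 H2) as [z Hz]. now exists (S (S z)).
Qed.

Lemma horn_pos w h1 h2 c :
  (exists z, holds w (horn h1 h2 (pos c) z)) <-> (on w h1 -> on w h2 -> on w c).
Proof.
  rewrite (horn_iff w h1 h2 (fun _ => pos c)). setoid_rewrite holds_pos.
  firstorder.
Qed.

(** A diverging program may receive spurious values. [m_fun] only forbids a positive value beside
    the value 0, which is enough for total programs. *)
Record model (w : nat -> bool) : Prop := {
  m_zero n : on w (rI (code_of PZero) n 0);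
  m_succ n : on w (rI (code_of PSucc) n (S n));
  m_id n : on w (rI (code_of PId) n n);
  m_fst n : on w (rI (code_of PFst) n (p1 n));
  m_snd n : on w (rI (code_of PSnd) n (p2 n));
  m_oracle n : on w (rI (code_of POracle) n 0);
  m_comp f g n m v : on w (rI g n m) -> on w (rI f m v) -> on w (rI (kComp f g) n v);
  m_pair f g n v u : on w (rI f n v) -> on w (rI g n u) ->
    on w (rI (kPair f g) n (pr v u));
  m_rec0 f g a v : on w (rI f a v) -> on w (rI (kRec f g) (pr a 0) v);
  m_recS f g a k u v : on w (rI (kRec f g) (pr a k) u) -> on w (rI g (pr a (pr k u)) v) ->
    on w (rI (kRec f g) (pr a (S k)) v);
  m_below0 f n : on w (bI f n 0);
  m_belowS f n k v : on w (bI f n k) -> on w (rI f (pr n k) (S v)) -> on w (bI f n (S k));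
  m_min f n k : on w (bI f n k) -> on w (rI f (pr n k) 0) -> on w (rI (kMin f) n k);
  m_fun c n v : on w (rI c n 0) -> ~ on w (rI c n (S v));
  m_node a b n s r : on w (mI a b n s r) -> on w (nodeI a n s) -> on w (nodeI b n r);
  m_step a b n s r v : on w (mI a b n s r) -> on w (nodeI a n s) ->
    exists u, on w (mI a b n (consc v s) (consc u r));
  m_compare a b n : on w (mI a b n 0 0) \/ on w (mI b a n 0 0)
}.

Definition rule_sat (w : nat -> bool) (F : nat -> nat -> nat) : Prop :=
  forall p, exists z, holds w (F p z).

Lemma sat_rules w : sat lits w <-> Forall (rule_sat w) rules.
Proof.
  split.
  - intros H. apply Forall_nth. intros i d Hi p.
    destruct (H (pr i p)) as [z Hz]. exists z. unfold lits, select in Hz.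
    rewrite p1_pr, p2_pr in Hz. now rewrite (nth_indep _ _ (fun p _ => pos (rI (pr 0 0) p 0))).
  - intros H m. unfold lits, select.
    destruct (lt_dec (p1 m) (length rules)) as [Hi|Hi].
    + apply (proj1 (Forall_nth _ _) H _ _ Hi).
    + rewrite nth_overflow by lia. inversion H as [|? ? H0 _]. apply H0.
Qed.

Ltac use_rule H x0 x1 x2 x3 x4 x5 :=
  let T := fresh in
  pose proof (proj1 (horn_pos _ _ _ _) (H (tuple x0 x1 x2 x3 x4 x5))) as T;
  let E0 := fresh in let E1 := fresh in let E2 := fresh in
  let E3 := fresh in let E4 := fresh in let E5 := fresh in
  destruct (tuple_proj x0 x1 x2 x3 x4 x5) as (E0 & E1 & E2 & E3 & E4 & E5);
  rewrite ?E0, ?E1, ?E2, ?E3, ?E4, ?E5 in T; clear E0 E1 E2 E3 E4 E5; revert T.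

Lemma sat_model w : sat lits w <-> model w.
Proof.
  rewrite sat_rules. unfold rules. rewrite !Forall_cons_iff. unfold rule_sat. split.
  - intros (H0 & H1 & H2 & H3 & H4 & H5 & H6 & H7 & H8 & H9 & H10 & H11 & H12 & H13
            & H14 & H15 & H16 & _).
    constructor.
    + intros n. destruct (H0 n) as [_ H]. now apply holds_pos in H.
    + intros n. destruct (H1 n) as [_ H]. now apply holds_pos in H.
    + intros n. destruct (H2 n) as [_ H]. now apply holds_pos in H.
    + intros n. destruct (H3 n) as [_ H]. now apply holds_pos in H.
    + intros n. destruct (H4 n) as [_ H]. now apply holds_pos in H.
    + intros n. destruct (H5 n) as [_ H]. now apply holds_pos in H.
    + intros f g n m v. use_rule H6 f g n m v 0. auto.
    + intros f g n v u. use_rule H7 f g n v u 0. auto.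
    + intros f g a v. use_rule H8 f g a v 0 0. auto.
    + intros f g a k u v. use_rule H9 f g a k u v. auto.
    + intros f n. destruct (H10 (tuple f n 0 0 0 0)) as [_ H]. apply holds_pos in H.
      now destruct (tuple_proj f n 0 0 0 0) as (-> & -> & _) in H.
    + intros f n k v. use_rule H11 f n k v 0 0. auto.
    + intros f n k. use_rule H12 f n k 0 0 0. auto.
    + intros c n v H. destruct (proj1 (horn_iff _ _ _ (fun _ => _)) (H13 (tuple c n v 0 0 0)))
        as [_ Hn];
        destruct (tuple_proj c n v 0 0 0) as (E0 & E1 & E2 & _); rewrite ?E0, ?E1, ?E2 in *;
        auto. now apply holds_neg.
    + intros a b n s r. use_rule H14 a b n s r 0. auto.
    + intros a b n s r v Hm Hn.
      destruct (proj1 (horn_iff _ _ _ (fun z => pos (mI (a0 _) (a1 _) (a2 _)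
          (consc (a5 _) (a3 _)) (consc (pred (pred z)) (a4 _))))) (H15 (tuple a b n s r v)))
        as [u Hu];
        destruct (tuple_proj a b n s r v) as (E0 & E1 & E2 & E3 & E4 & E5);
        rewrite ?E0, ?E1, ?E2, ?E3, ?E4, ?E5 in *; auto.
      exists u. now apply holds_pos in Hu.
    + intros a b n. destruct (H16 (tuple a b n 0 0 0)) as [z Hz]. apply holds_pos in Hz.
      destruct (tuple_proj a b n 0 0 0) as (E0 & E1 & E2 & _); rewrite ?E0, ?E1, ?E2 in Hz.
      destruct z; auto.
  - intros M. repeat apply conj; try intros p; try apply horn_pos.
    1-6, 11: exists 0; apply holds_pos.
    + apply (m_zero _ M).
    + apply (m_succ _ M).
    + apply (m_id _ M).
    + apply (m_fst _ M).
    + apply (m_snd _ M).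
    + apply (m_oracle _ M).
    + apply (m_below0 _ M).
    + apply (m_comp _ M).
    + apply (m_pair _ M).
    + intros H _. now apply (m_rec0 _ M).
    + apply (m_recS _ M).
    + apply (m_belowS _ M).
    + apply (m_min _ M).
    + apply (horn_iff _ _ _ (fun _ => _)). intros H _. exists 0.
      apply holds_neg. now apply (m_fun _ M).
    + apply (m_node _ M).
    + apply (horn_iff _ _ _ (fun z => pos (mI (a0 p) (a1 p) (a2 p)
          (consc (a5 p) (a3 p)) (consc (pred (pred z)) (a4 p))))).
      intros Hm Hn. destruct (m_step _ M _ _ _ _ _ (a5 p) Hm Hn) as [u Hu].
      exists u. now apply holds_pos.
    + destruct (m_compare _ M (a0 p) (a1 p) (a2 p)) as [H|H]; [exists 0 | exists 1];
        now apply holds_pos.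
    + constructor.
Qed.

(** * The standard model: true evaluation and the greatest simulation *)

Fixpoint decode_upto (k n : nat) : pcode :=
  match k with
  | 0 => PZero
  | S k =>
    match p1 n with
    | 0 => PZero
    | 1 => PSucc
    | 2 => PId
    | 3 => PFst
    | 4 => PSnd
    | 5 => POracle
    | 6 => PComp (decode_upto k (p1 (p2 n))) (decode_upto k (p2 (p2 n)))
    | 7 => PPair (decode_upto k (p1 (p2 n))) (decode_upto k (p2 (p2 n)))
    | 8 => PRec (decode_upto k (p1 (p2 n))) (decode_upto k (p2 (p2 n)))
    | _ => PMin (decode_upto k (p2 n))
    end
  end.

(** The rules range over all numbers, so each must denote a program. The components of a compound
    code are smaller than it because its tag is positive; hence fuel [S n] suffices. *)
Definition decode (n : nat) : pcode := decode_upto (S n) n.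

Lemma pr_gt_r a b : 0 < a -> b < pr a b.
Proof.
  Transparent pr. unfold pr. Opaque pr.
  pose proof (to_nat_non_decreasing a b). lia.
Qed.

Lemma decode_upto_stable k : forall k' n,
  n < k -> n < k' -> decode_upto k n = decode_upto k' n.
Proof.
  induction k as [|k IH]; intros [|k'] n Hk Hk'; try lia. simpl.
  pose proof (pr_gt_r (p1 n) (p2 n)) as H. rewrite pr_proj in H.
  pose proof (pr_le_l (p1 (p2 n)) (p2 (p2 n))) as Hl. rewrite pr_proj in Hl.
  pose proof (pr_le_r (p1 (p2 n)) (p2 (p2 n))) as Hr. rewrite pr_proj in Hr.
  destruct (p1 n) as [|[|[|[|[|[|[|[|[|?]]]]]]]]]; try reflexivity;
    f_equal; apply IH; lia.
Qed.

Lemma decode_pr t m : 0 < t -> decode (pr t m) =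
  match t with
  | 0 => PZero
  | 1 => PSucc
  | 2 => PId
  | 3 => PFst
  | 4 => PSnd
  | 5 => POracle
  | 6 => PComp (decode (p1 m)) (decode (p2 m))
  | 7 => PPair (decode (p1 m)) (decode (p2 m))
  | 8 => PRec (decode (p1 m)) (decode (p2 m))
  | _ => PMin (decode m)
  end.
Proof.
  intros Ht. unfold decode at 1. cbn [decode_upto]. rewrite p1_pr, p2_pr.
  pose proof (pr_gt_r t m Ht) as H.
  pose proof (pr_le_l (p1 m) (p2 m)) as Hl. rewrite pr_proj in Hl.
  pose proof (pr_le_r (p1 m) (p2 m)) as Hr. rewrite pr_proj in Hr.
  assert (Hup : forall n, n < pr t m -> decode_upto (pr t m) n = decode n)
    by (intros; apply decode_upto_stable; lia).
  rewrite !Hup by lia.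
  reflexivity.
Qed.

Lemma decode_kComp f g : decode (kComp f g) = PComp (decode f) (decode g).
Proof. unfold kComp. rewrite decode_pr, p1_pr, p2_pr by lia. reflexivity. Qed.

Lemma decode_kPair f g : decode (kPair f g) = PPair (decode f) (decode g).
Proof. unfold kPair. rewrite decode_pr, p1_pr, p2_pr by lia. reflexivity. Qed.

Lemma decode_kRec f g : decode (kRec f g) = PRec (decode f) (decode g).
Proof. unfold kRec. rewrite decode_pr, p1_pr, p2_pr by lia. reflexivity. Qed.

Lemma decode_kMin f : decode (kMin f) = PMin (decode f).
Proof. unfold kMin. now rewrite decode_pr by lia. Qed.

Lemma decode_code_of p : decode (code_of p) = p.
Proof.
  induction p; simpl;
    rewrite ?decode_kComp, ?decode_kPair, ?decode_kRec, ?decode_kMin; try congruence;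
    try (now rewrite decode_pr by lia).
  unfold decode. simpl. now rewrite p1_pr.
Qed.

Definition evalc (c n v : nat) : Prop := eval no_oracle (decode c) n v.

Definition posbelow (f n k : nat) : Prop :=
  forall j, j < k -> exists v, evalc f (pr n j) (S v).

Definition node (a n s : nat) : Prop := evalc a (pr n (revc s)) 0.

(** Pairs whose first entry is not a node are unconstrained, so a dead end is simulated by
    everything. *)
Definition simulation (a b n : nat) (Z : nat -> nat -> Prop) : Prop :=
  forall s r, Z s r -> node a n s ->
    node b n r /\ forall v, exists u, Z (consc v s) (consc u r).

Definition similar (a b n s r : nat) : Prop := exists Z, simulation a b n Z /\ Z s r.

(** Simulations are closed under unions, so [similar] is the greatest one. *)
Lemma similar_simulation a b n : simulation a b n (similar a b n).
Proof.
  intros s r (Z & HZ & Hsr) Hs. destruct (HZ s r Hsr Hs) as [Hr Hv].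
  split; [exact Hr|]. intros v. destruct (Hv v) as [u Hu]. exists u, Z. auto.
Qed.

(* The complement of the greatest simulation is a simulation in the other direction. *)
Lemma similar_total a b n s r : similar a b n s r \/ similar b a n r s.
Proof.
  destruct (classic (similar a b n s r)) as [H|H]; [auto | right].
  exists (fun r s => ~ similar a b n s r). split; [|exact H].
  clear. intros r s Hno Hr.
  assert (Hgen : ~ (node a n s -> node b n r /\
            forall v, exists u, similar a b n (consc v s) (consc u r))).
  { intros Hs. apply Hno.
    (* Adjoining this pair to [similar] would still give a simulation, against maximality. *)
    exists (fun s' r' => (s' = s /\ r' = r) \/ similar a b n s' r'). split; [|auto].
    intros s' r' [[-> ->]|H] Hn.
    - destruct (Hs Hn) as [Hb Hv]. split; [exact Hb|].
      intros v. destruct (Hv v) as [u Hu]. eauto.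
    - destruct (similar_simulation a b n s' r' H Hn) as [Hb Hv]. split; [exact Hb|].
      intros v. destruct (Hv v) as [u Hu]. eauto. }
  (* If this [u] were suitable for every [v], it would answer all of them at once, which [Hgen]
     forbids. *)
  split; [tauto|]. intros u. apply NNPP. intros Hu. apply Hgen. intros _.
  split; [exact Hr|]. intros v. exists u. apply NNPP. eauto.
Qed.

Definition standard (i : nat) : Prop :=
  match p1 i with
  | 0 => evalc (a1 i) (a2 i) (p2 (p2 (p2 i)))
  | 1 => posbelow (a1 i) (a2 i) (p2 (p2 (p2 i)))
  | _ => similar (a1 i) (a2 i) (a3 i) (a4 i) (p2 (p2 (p2 (p2 (p2 i)))))
  end.

Lemma standard_rI c n v : standard (rI c n v) <-> evalc c n v.
Proof. unfold standard, rI, a1, a2. now rewrite ?p2_pr, ?p1_pr. Qed.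

Lemma standard_bI f n k : standard (bI f n k) <-> posbelow f n k.
Proof. unfold standard, bI, a1, a2. now rewrite ?p2_pr, ?p1_pr. Qed.

Lemma standard_mI a b n s r : standard (mI a b n s r) <-> similar a b n s r.
Proof. unfold standard, mI, a1, a2, a3, a4. now rewrite ?p2_pr, ?p1_pr. Qed.

Lemma model_exists : exists w, model w.
Proof.
  set (w := fun i => if excluded_middle_informative (standard i) then true else false).
  exists w.
  assert (Hw : forall i, on w i <-> standard i).
  { intros i. unfold on, w. destruct (excluded_middle_informative _); intuition discriminate. }
  assert (HR : forall c n v, on w (rI c n v) <-> evalc c n v)
    by (intros; now rewrite Hw, standard_rI).
  assert (HB : forall f n k, on w (bI f n k) <-> posbelow f n k)
    by (intros; now rewrite Hw, standard_bI).
  assert (HM : forall a b n s r, on w (mI a b n s r) <-> similar a b n s r)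
    by (intros; now rewrite Hw, standard_mI).
  constructor; unfold nodeI; intros *;
    rewrite ?HR, ?HB, ?HM; unfold evalc;
    rewrite ?decode_code_of, ?decode_kComp, ?decode_kPair, ?decode_kRec, ?decode_kMin.
  - constructor.
  - constructor.
  - constructor.
  - apply eval_fst.
  - apply eval_snd.
  - apply (eOracle no_oracle).
  - intros Hg Hf. econstructor; eauto.
  - apply eval_pair.
  - apply eval_rec0.
  - apply eval_recS.
  - intros j Hj. lia.
  - intros Hb Hv j Hj. destruct (Nat.eq_dec j k) as [->|]; [exists v; exact Hv|].
    apply Hb. lia.
  - intros Hb H0. apply eMin; [exact H0 | exact Hb].
  - intros H0 HS. discriminate (eval_det _ _ _ _ _ H0 HS).
  - intros H Hs. now apply (similar_simulation a b n s r H).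
  - intros H Hs. destruct (similar_simulation a b n s r H Hs) as [_ Hv].
    destruct (Hv v) as [u Hu]. exists u. now apply HM.
  - apply similar_total.
Qed.

(** * What holds in every model *)

Section Model.
Variables (w : nat -> bool) (M : model w).

(** The clauses follow the evaluation rules. Minimisation has a premise for each [j < k], which the
    chain of bits [bI] cuts into clauses with two premises. *)
Lemma model_eval p : forall n v, eval no_oracle p n v -> on w (rI (code_of p) n v).
Proof.
  induction p; intros n v H.
  - inversion H; subst. apply (m_zero _ M).
  - inversion H; subst. apply (m_succ _ M).
  - inversion H; subst. apply (m_id _ M).
  - inversion H; subst. apply (m_fst _ M).
  - inversion H; subst. apply (m_snd _ M).
  - inversion H; subst. apply (m_oracle _ M).
  - inversion H; subst. eapply (m_comp _ M); eauto.
  - inversion H; subst. change (to_nat (?x, ?y)) with (pr x y).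
    apply (m_pair _ M); auto.
  - rewrite <- (pr_proj n) in *. revert v H. generalize (p2 n) as k, (p1 n) as a.
    induction k as [|k IH]; intros a v H;
      inversion H as [| | | | | | | |? ? ? a' ? E Hv|? ? ? a' k' u ? E Hu Hv|]; subst;
      rewrite of_nat_pr in E; try discriminate E.
    + injection E as <-. apply (m_rec0 _ M). auto.
    + injection E as <- <-. eapply (m_recS _ M); [apply IH | apply IHp2]; eassumption.
  - inversion H as [| | | | | | | | | | ? ? ? H0 Hpos]; subst.
    assert (Hb : forall k, k <= v -> on w (bI (code_of p) n k)).
    { induction k as [|k IH]; intros Hk; [apply (m_below0 _ M)|].
      destruct (Hpos k Hk) as [u Hu].
      eapply (m_belowS _ M); [apply IH; lia | apply IHp; exact Hu]. }
    apply (m_min _ M); auto.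
Qed.

Lemma model_zero p n : total no_oracle p ->
  (on w (rI (code_of p) n 0) <-> eval no_oracle p n 0).
Proof.
  intros Hp. split; [|apply model_eval]. intros H.
  destruct (Hp n) as [[|v] Hv]; [exact Hv|].
  destruct (m_fun _ M _ _ v H). now apply model_eval.
Qed.

Definition has_path (p : pcode) (n : nat) : Prop :=
  exists f : nat -> nat,
    forall k, eval no_oracle p (pr n (code_nats (prefix f k))) 0.

Lemma model_node p n l : total no_oracle p ->
  (on w (nodeI (code_of p) n (code_nats (rev l))) <->
   eval no_oracle p (pr n (code_nats l)) 0).
Proof.
  intros Hp. unfold nodeI. rewrite revc_nats, rev_involutive. now apply model_zero.
Qed.

(** The values of [f] are fed one by one to [m_step], whose answers form [g]; [m_node] shows that
    the prefixes of [g] are nodes. *)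
Lemma model_path p q n :
  total no_oracle p -> total no_oracle q ->
  on w (mI (code_of p) (code_of q) n 0 0) -> has_path p n -> has_path q n.
Proof.
  intros Hp Hq Hroot [f Hf].
  destruct (path_exists (fun t => on w (mI (code_of p) (code_of q) n
      (code_nats (rev (prefix f (length t)))) (code_nats (rev t)))) (fun _ _ => True))
    as [g Hg].
  - exact Hroot.
  - intros t Ht.
    destruct (m_step _ M _ _ _ _ _ (f (length t)) Ht) as [u Hu];
      [now apply model_node|].
    exists u. split; [trivial|].
    now rewrite length_app, Nat.add_1_r, prefix_S, !rev_app_distr.
  - exists g. intros k. apply model_node; [exact Hq|].
    destruct (Hg k) as [Hk _].
    apply (m_node _ M _ _ _ _ _ Hk). now apply model_node.
Qed.

(** Exactly one tree has a path. If it is that of [q], this bit cannot be set, as the path would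
    carry over to [p]; if it is that of [p], the opposite bit cannot be set, and [m_compare] sets
    this one. *)
Lemma model_compare p q n (b : bool) :
  total no_oracle p -> total no_oracle q ->
  (has_path p n <-> b = true) -> (has_path q n <-> b = false) ->
  w (mI (code_of q) (code_of p) n 0 0) = b.
Proof.
  intros Hp Hq Hpn Hqn.
  pose proof (model_path p q n Hp Hq) as Hpq.
  pose proof (model_path q p n Hq Hp) as Hqp.
  pose proof (m_compare _ M (code_of p) (code_of q) n) as Hor. unfold on in *.
  destruct b.
  - destruct Hor as [H|H]; [|exact H].
    assert (has_path p n) as P by now apply Hpn.
    apply Hpq in P; [|exact H]. now apply Hqn in P.
  - destruct (w (mI (code_of q) _ _ _ _)); [|reflexivity].
    symmetry. apply Hpn. apply Hqp; [reflexivity | now apply Hqn].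
Qed.

End Model.

(** Turns the matrix of a [Pi11] form into a tree: a path of [b'] is a function none of whose
    prefixes [b] accepts. *)
Lemma complement_code b : total no_oracle b ->
  exists b', total no_oracle b' /\
    forall n, eval no_oracle b' n 0 <-> ~ eval no_oracle b n 0.
Proof.
  intros Hb.
  destruct (computable_ifz no_oracle (fun n => n) (fun _ => 1) (fun _ => 0)) as [c Hc];
    auto with comp.
  exists (PComp c b). split.
  - intros n. destruct (Hb n) as [v Hv]. exists (ifz v 1 0). econstructor; eauto.
  - intros n. destruct (Hb n) as [v Hv]. split.
    + intros H H0. inversion H as [| | | | | |? ? ? m ? Hm H1| | | |]; subst.
      rewrite (eval_det _ _ _ _ _ Hm H0) in H1.
      discriminate (eval_det _ _ _ _ _ (Hc 0) H1).
    + intros H. destruct v as [|v]; [contradiction|].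
      apply eComp with (m := S v); [exact Hv | exact (Hc (S v))].
Qed.

Lemma hyperarithmetic_bits H : hyperarithmetic H ->
  exists a b, forall w, model w -> forall n, w (mI b a n 0 0) = H n.
Proof.
  intros [(p & Hp & HpH) (q0 & Hq0 & HqH)].
  destruct (complement_code q0 Hq0) as (q & Hq & Hqc).
  exists (code_of p), (code_of q). intros w M n. apply model_compare; auto.
  - symmetry. apply HpH.
  - rewrite <- Bool.not_true_iff_false, HqH. unfold has_path. split.
    + intros [f Hf] Hall. destruct (Hall f) as [k Hk].
      exact (proj1 (Hqc _) (Hf k) Hk).
    + intros Hno. apply not_all_ex_not in Hno. destruct Hno as [f Hf].
      exists f. intros k. apply Hqc. intros Hk. apply Hf. now exists k.
Qed.

(** * Computing from a class of positive measure *)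

Lemma computable_min X F :
  computable X (fun m => F (p1 m) (p2 m)) -> (forall n, exists k, F n k = 0) ->
  exists h, computable X h /\ forall n, F n (h n) = 0.
Proof.
  intros [d Hd] Hex.
  assert (Hleast : forall n, exists k, F n k = 0 /\ forall j, j < k -> F n j <> 0).
  { intros n. destruct (dec_inh_nat_subset_has_unique_least_element (fun k => F n k = 0))
      as (k & (Hk & Hmin) & _); [intros; lia | apply Hex |].
    exists k. split; [exact Hk|]. intros j Hj H. specialize (Hmin j H). lia. }
  set (h := fun n => proj1_sig (constructive_indefinite_description _ (Hleast n))).
  assert (Hh : forall n, F n (h n) = 0 /\ forall j, j < h n -> F n j <> 0).
  { intros n. exact (proj2_sig (constructive_indefinite_description _ (Hleast n))). }
  assert (HdF : forall n k, eval X d (pr n k) (F n k)).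
  { intros n k. generalize (Hd (pr n k)). now rewrite p1_pr, p2_pr. }
  exists h. split; [|apply Hh].
  exists (PMin d). intros n. destruct (Hh n) as [H0 Hpos]. apply eMin.
  - change (to_nat (?a, ?b)) with (pr a b). rewrite <- H0. apply HdF.
  - intros j Hj. change (to_nat (?a, ?b)) with (pr a b).
    exists (pred (F n j)). rewrite Nat.succ_pred by now apply Hpos. apply HdF.
Qed.

Lemma total_function X e : total X e -> exists E, forall n, eval X e n (E n).
Proof.
  intros He. exists (fun n => proj1_sig (constructive_indefinite_description _ (He n))).
  intros n. exact (proj2_sig (constructive_indefinite_description _ (He n))).
Qed.

(** The coded list continued by zeros, since [dropc] and [headc] give 0 past its end. Thus every
    number names a point, and searches over numbers need no validity check. *)
Definition bitseq (t : nat) : cantor := fun j => nz (headc (dropc j t)).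

Definition bitc (t j : nat) : nat := ifz (headc (dropc j t)) 0 1.

Definition prefixc (t j : nat) : nat :=
  revc (prec 0 (fun i acc => consc (bitc t i) acc) j).

Lemma bitc_spec t j : bitc t j = bit (bitseq t j).
Proof. unfold bitc, bitseq. now destruct (headc _). Qed.

Lemma prefixc_spec t j : prefixc t j = code_bits (prefix (bitseq t) j).
Proof.
  unfold prefixc. rewrite code_bits_nats.
  rewrite <- (rev_involutive (map bit _)), <- revc_nats. f_equal.
  induction j as [|j IH]; [reflexivity|].
  simpl prec. now rewrite IH, prefix_S, map_app, rev_app_distr, bitc_spec.
Qed.

Lemma bitseq_code y n j : j < n -> bitseq (code_bits (prefix y n)) j = y j.
Proof.
  intros H. unfold bitseq. rewrite code_bits_nats, dropc_nats, skipn_map.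
  destruct (skipn_prefix y j n H) as [l ->].
  cbn [map]. rewrite code_nats_cons, headc_consc. now destruct (y j).
Qed.

(** The code of a string of ones, by monotonicity of pairing the largest code of a bit string of
    that length. *)
Definition bits_bound (n : nat) : nat := prec 0 (fun _ w => consc 1 w) n.

Lemma code_bits_bound l : code_bits l <= bits_bound (length l).
Proof.
  induction l as [|b l IH]; [reflexivity|].
  change (S (pr (bit b) (code_bits l)) <= S (pr 1 (bits_bound (length l)))).
  apply le_n_S, pr_mono; [destruct b; simpl; lia | exact IH].
Qed.

Lemma prefix_ext {A} (y z : nat -> A) n :
  (forall j, j < n -> y j = z j) -> prefix y n = prefix z n.
Proof.
  intros H. unfold prefix. apply map_ext_in. intros j Hj. apply in_seq in Hj.
  apply H. lia.
Qed.

Lemma computable_bitc X f g :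
  computable X f -> computable X g -> computable X (fun n => bitc (f n) (g n)).
Proof. intros. unfold bitc. auto with comp. Qed.

Lemma computable_prefixc X f g :
  computable X f -> computable X g -> computable X (fun n => prefixc (f n) (g n)).
Proof.
  intros. unfold prefixc. apply computable_revc.
  apply (computable_prec X (fun _ => 0) (fun n i acc => consc (bitc (f n) i) acc));
    auto with comp.
  apply computable_consc; auto with comp.
  apply computable_bitc; auto with comp.
  apply (computable_comp X f); auto with comp.
Qed.

Lemma computable_bits_bound X g : computable X g -> computable X (fun n => bits_bound (g n)).
Proof.
  intros. unfold bits_bound.
  apply (computable_prec X (fun _ => 0) (fun _ _ w => consc 1 w)); auto with comp.
Qed.

#[local] Hint Resolve computable_bitc computable_prefixc computable_bits_bound : comp.

(* By compactness some level of the tree of [P] already decides the bit at [i n]; the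
   search runs over pairs [k] of a level and a candidate value. *)
Lemma forced_bits_turing_le x P i H :
  Pi01_rel x P -> (exists y, P y) -> computable x i ->
  (forall y, P y -> forall n, y (i n) = H n) -> turing_le H x.
Proof.
  intros (e & He & HP) [y0 Hy0] Hi Hforced.
  destruct (total_function x e He) as [E HE].
  assert (HEc : computable x E) by (exists e; exact HE).
  assert (HPE : forall y, P y <-> forall n, E (code_bits (prefix y n)) = 0).
  { intros y. rewrite HP. split; intros Hn n; specialize (Hn n).
    - exact (eval_det _ _ _ _ _ (HE _) Hn).
    - rewrite <- Hn. apply HE. }
  (* Beyond both the level named by [k] and the position [i n], so a prefix of this length contains
     the bit. *)
  set (level := fun n k => S (pr (p1 k) (i n))).
  set (alive := fun l t => bsum (fun j => E (prefixc t j)) (S l)).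
  set (wrong := fun n k t =>
    ifz (alive (level n k) t) (ifz (p2 k) (bitc t (i n)) (ifz (bitc t (i n)) 1 0)) 0).
  set (F := fun n k => bsum (wrong n k) (S (bits_bound (level n k)))).
  assert (Halive : forall l t, alive l t = 0 <->
            forall j, j <= l -> E (code_bits (prefix (bitseq t) j)) = 0).
  { intros l t. unfold alive. rewrite bsum_zero.
    split; intros Ha j Hj; specialize (Ha j); rewrite prefixc_spec in *; apply Ha; lia. }
  assert (Hwrong : forall n k t, wrong n k t = 0 <->
            (alive (level n k) t = 0 -> bitseq t (i n) = nz (p2 k))).
  { intros n k t. unfold wrong. rewrite bitc_spec.
    destruct (alive (level n k) t), (p2 k), (bitseq t (i n)); simpl; intuition congruence. }
  destruct (computable_min x F) as (h & Hh & HF).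
  - assert (Hlev : computable x (fun m => level (p1 m) (p2 m))).
    { unfold level. apply computable_S, computable_pr; auto with comp.
      apply (computable_comp x i); auto with comp. }
    assert (Hal : computable x (fun m => alive (p1 m) (p2 m))).
    { unfold alive. apply (computable_bsum x (fun m j => E (prefixc (p2 m) j)));
        auto with comp.
      apply (computable_comp x E); auto with comp. }
    unfold F.
    apply (computable_bsum x (fun m => wrong (p1 m) (p2 m))
             (fun m => S (bits_bound (level (p1 m) (p2 m))))); auto with comp.
    assert (Hbit : computable x (fun m => bitc (p2 m) (i (p1 (p1 m))))).
    { apply computable_bitc; auto with comp. apply (computable_comp x i); auto with comp. }
    unfold wrong. apply computable_ifz; auto with comp.
    apply computable_ext with (f := fun m => (fun m => alive (p1 m) (p2 m))
      (pr ((fun m => level (p1 m) (p2 m)) (p1 m)) (p2 m))).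
    + intros m. cbv beta. now rewrite p1_pr, p2_pr.
    + apply (computable_comp x (fun m => alive (p1 m) (p2 m))); auto with comp.
      apply computable_pr; auto with comp.
      apply (computable_comp x (fun m => level (p1 m) (p2 m))); auto with comp.
  - intros n.
    (* Each point either leaves [P] at some stage or shows the forced bit, so these strings form a
       bar, and [fan] yields the level [L] at which the search succeeds. *)
    destruct (fan (fun t => E (code_bits t) <> 0 \/
      (i n < length t /\ nth (i n) t false = H n))) as [L HL].
    { intros y. destruct (classic (P y)) as [Hy|Hy].
      - exists (S (i n)). right. rewrite prefix_length. split; [lia|].
        rewrite prefix_S, app_nth2; rewrite prefix_length; [|lia].
        rewrite Nat.sub_diag. now apply Hforced.
      - rewrite HPE in Hy. apply not_all_ex_not in Hy. destruct Hy as [m Hm]. eauto. }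
    exists (pr L (bit (H n))). apply bsum_zero. intros t _. apply Hwrong.
    rewrite Halive, p2_pr. intros Ha.
    destruct (HL (bitseq t)) as (m & Hm & [Hd | [Hlt Hd]]).
    + destruct Hd. apply Ha. unfold level. rewrite p1_pr. pose proof (pr_le_l L (i n)). lia.
    + rewrite prefix_length in Hlt. unfold prefix in Hd.
      rewrite (nth_indep _ _ (bitseq t 0)), map_nth, seq_nth in Hd
        by (rewrite ?length_map, ?length_seq; exact Hlt).
      simpl in Hd. rewrite Hd. now destruct (H n).
  - destruct (computable_ifz x (fun n => p2 (h n)) (fun _ => 0) (fun _ => 1)) as [d Hd];
      auto with comp.
    exists d. intros n.
    replace (if H n then 1 else 0) with (ifz (p2 (h n)) 0 1); [apply Hd|].
    set (k := h n). set (l := level n k).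
    (* Whichever [k] the search returns, the prefix of the member [y0] survives to its level and so
       certifies the candidate value. *)
    set (t := code_bits (prefix y0 l)).
    assert (Hpos : i n < l) by (unfold l, level; pose proof (pr_le_r (p1 k) (i n)); lia).
    assert (Ht : wrong n k t = 0).
    { refine (proj1 (bsum_zero _ _) (HF n) t _).
      pose proof (code_bits_bound (prefix y0 l)) as Hb. rewrite prefix_length in Hb.
      fold k. fold l. unfold t. lia. }
    assert (Hb : bitseq t (i n) = nz (p2 k)).
    { apply (proj1 (Hwrong n k t) Ht). apply Halive. intros j Hj.
      rewrite (prefix_ext _ y0); [now apply HPE|].
      intros j' Hj'. apply bitseq_code. fold l in Hj. lia. }
    unfold t in Hb. rewrite bitseq_code, (Hforced y0 Hy0) in Hb by exact Hpos.
    rewrite Hb. now destruct (p2 k).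
Qed.

(** * Choice of the sparsity, and conclusion *)

Lemma sparse_factor (s : R) : (s < 1)%R ->
  exists q, 0 < q /\ (INR q * s <= INR q - 1)%R.
Proof.
  intros Hs. destruct (archimed (/ (1 - s))) as [Hup _].
  assert (Hinv : (0 < / (1 - s))%R) by (apply Rinv_0_lt_compat; lra).
  (* An integer above 1/(1-s), so that 1/q is at most 1 - s. *)
  exists (Z.to_nat (up (/ (1 - s)))).
  assert (Hz : (0 < up (/ (1 - s)))%Z) by (apply lt_IZR; lra).
  split; [lia|].
  rewrite INR_IZR_INZ, Z2Nat.id by lia.
  assert (1 <= IZR (up (/ (1 - s))) * (1 - s))%R; [|lra].
  apply Rle_trans with (/ (1 - s) * (1 - s))%R; [rewrite Rinv_l; lra|].
  apply Rmult_le_compat_r; lra.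
Qed.

Theorem mainTheorem14 (s : Q) (hs0 : (0 < s)%Q) (hs1 : (s < 1)%Q) :
  exists G : cls,
    Pi02 G /\ Hs_pos (Q2R s) G /\
    forall x : cantor,
      (exists P : cls, Pi01_rel x P /\ (forall y, P y -> G y) /\ Hs_pos (Q2R s) P) ->
      forall H : nat -> bool, hyperarithmetic H -> turing_le H x.
Proof.
  apply Qreals.Qlt_Rlt in hs0, hs1. unfold Q2R at 1 in hs0. unfold Q2R at 2 in hs1.
  simpl in hs0, hs1.
  destruct (sparse_factor (Q2R s)) as (q & Hq & Hqs); [lra|].
  exists (fun y => sat lits (sparse q y)). split; [|split].
  - apply sparse_sat_Pi02, lits_computable.
  - destruct model_exists as [w Hw].
    apply sparse_Hs_pos with (q := q) (w := w); auto.
    intros y Hy m. apply sat_model in Hw. destruct (Hw m) as [z Hz].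
    exists z. unfold holds. now rewrite Hy.
  - intros x (P & HP & HPG & Hpos) H HH.
    destruct (hyperarithmetic_bits H HH) as (a & b & Hbits).
    (* The factor [q] appears because [sparse] reads bit j of the model at position qj of [y]. *)
    apply (forced_bits_turing_le x P (fun n => q * mI b a n 0 0)); auto.
    + apply Hs_pos_inhabited with (s := Q2R s); [lra | exact Hpos].
    + unfold mI. auto 20 with comp.
    + intros y Hy n. apply (Hbits (sparse q y)). now apply sat_model, HPG.
Qed.
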